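(* Let $m\ge1$. The number $\mathsf S_m(n,k)$ counts the arrangements of $n$ labeled marbles, placed one at a time in the order $1,2,\dots,n$, into $k$ compartments distributed across urns with $m$ unlabeled compartments each, subject to the following constraints: within an urn, a compartment may receive a second marble only after every compartment of that urn is non-empty; and a new urn may be opened only when all compartments of all previously used urns are non-empty. Consequently the composite $m$-Bell number $B^{(m)}_n$ counts all such arrangements of $n$ marbles (over all $k$), and the primitive $m$-Bell number $B^{(m,r)}_n$ $(0\le r<m)$ counts those in which the number of used compartments is $\equiv r\pmod m$.
   Context: Conventions for arrangements: the first marble may be placed in any compartment of any urn; once all compartments of an urn have been used, marbles may be freely placed in any of its compartments. Both the urns and the compartments within each urn are indistinguishable: two placements count as the same arrangement precisely when one is obtained from the other by permuting urns and by permuting compartments within urns. Unused (empty) compartments are suppressed, and $k$ counts the non-empty compartments. Equivalently, the urns, and the compartments within each urn, may be ordered canonically by first use, so that ''open a new compartment'' is a single well-defined move at every step. $\mathsf S_m(n,k)$ is defined for $n,k\ge0$ by $\mathsf S_m(0,k)=\delta_{0,k}$, $\mathsf S_m(n,k)=0$ for $k<0$, and $\mathsf S_m(n+1,k)=m\lfloor k/m\rfloor\,\mathsf S_m(n,k)+\mathsf S_m(n,k-1)$. For $0\le r<m$, $(B^{(m,r)}_n)_{n\ge0}$ is the unique solution of $a_{n+m}=\sum_{k=0}^n\binom nk m^{\,n-k}a_k$ $(n\ge0)$ with $B^{(m,r)}_n=\delta_{n,r}$ for $0\le n<m$, and $B^{(m)}=\sum_{r=0}^{m-1}B^{(m,r)}$.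 *)

(* Defs.v *)
From HB Require Import structures.
From mathcomp Require Import all_boot all_fingroup.

Set Implicit Arguments.
Unset Strict Implicit.
Unset Printing Implicit Defensive.

(* S_m(n, k); the 0 in the recursive case is S_m(n, -1). *)
Fixpoint mstirling (m n k : nat) : nat :=
  if n is n'.+1 then
    m * (k %/ m) * mstirling m n' k
    + (if k is k'.+1 then mstirling m n' k' else 0)
  else (k == 0).

Definition is_primitive_bell (m r : nat) (a : nat -> nat) : Prop :=
  (forall n, n < m -> a n = (n == r)) /\
  (forall n, a (n + m) = \sum_(k < n.+1) 'C(n, k) * m ^ (n - k) * a k).

(* B^(m,r)_0, ..., B^(m,r)_(N-1) by course-of-values recursion; for m >= 1    *)
(* this is the unique solution of is_primitive_bell: see primitive_bellP and  *)
(* primitive_bell_unique.                                                     *)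
Fixpoint primitive_bell_seq (m r N : nat) : seq nat :=
  if N is N'.+1 then
    let s := primitive_bell_seq m r N' in
    rcons s (if N' < m then (N' == r : nat) else
      \sum_(k < (N' - m).+1) 'C(N' - m, k) * m ^ (N' - m - k) * nth 0 s k)
  else [::].

Definition primitive_bell (m r n : nat) : nat :=
  nth 0 (primitive_bell_seq m r n.+1) n.

Definition composite_bell (m n : nat) : nat :=
  \sum_(r < m) primitive_bell m r n.

Lemma size_primitive_bell_seq m r N : size (primitive_bell_seq m r N) = N.
Proof. by elim: N => //= N IHN; rewrite size_rcons IHN. Qed.

Lemma nth_primitive_bell_seq m r N k :
  k < N -> nth 0 (primitive_bell_seq m r N) k = primitive_bell m r k.
Proof.
elim: N => // N IHN; rewrite ltnS leq_eqVlt => /predU1P[-> //|ltkN].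
by rewrite /= nth_rcons size_primitive_bell_seq ltkN IHN.
Qed.

Lemma primitive_bellP m r : 0 < m -> is_primitive_bell m r (primitive_bell m r).
Proof.
move=> m_gt0; split=> n => [ltnm|].
  by rewrite /primitive_bell /= nth_rcons size_primitive_bell_seq ltnn eqxx ltnm.
rewrite {1}/primitive_bell /= nth_rcons size_primitive_bell_seq ltnn eqxx.
rewrite ltnNge leq_addl /= addnK; apply: eq_bigr => k _.
rewrite nth_primitive_bell_seq // (leq_trans (ltn_ord k)) //.
by rewrite -addn1 leq_add2l.
Qed.

Lemma primitive_bell_unique m r a :
  0 < m -> is_primitive_bell m r a -> a =1 primitive_bell m r.
Proof.
move=> m_gt0 [a_lt a_rec]; have [b_lt b_rec] := primitive_bellP r m_gt0.
elim/ltn_ind => n IHn; have [ltnm|lemn] := ltnP n m.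
  by rewrite a_lt // b_lt.
rewrite -(subnK lemn) a_rec b_rec; apply: eq_bigr => k _.
rewrite IHn //; apply: leq_trans (ltn_ord k) _.
by rewrite ltn_subrL m_gt0 (leq_trans m_gt0 lemn).
Qed.

(* Marbles are 'I_n, placed in increasing order; there are N distinguishable  *)
(* urns (N >= n amounts to an unlimited supply) with m distinguishable        *)
(* compartments each.  Indistinguishability comes from same_arrangement.      *)
Definition placement (m N n : nat) := {ffun 'I_n -> 'I_N * 'I_m}.

Section Placements.
Variables m N n : nat.
Implicit Types (f g : placement m N n) (i : 'I_n) (u : 'I_N).

Definition occupied_before f i (x : 'I_N * 'I_m) : bool :=
  [exists j : 'I_n, (j < i) && (f j == x)].

Definition urn_full_before f i u : bool :=
  [forall c : 'I_m, occupied_before f i (u, c)].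

Definition urn_used_before f i u : bool :=
  [exists c : 'I_m, occupied_before f i (u, c)].

Definition admissible_step f i : bool :=
  (occupied_before f i (f i) ==> urn_full_before f i (f i).1)
  && (~~ urn_used_before f i (f i).1 ==>
       [forall u, urn_used_before f i u ==> urn_full_before f i u]).

Definition admissible f : bool := [forall i, admissible_step f i].

Definition nb_compartments f : nat := #|[set f i | i in 'I_n]|.

Definition relabel (s : {perm 'I_N}) (t : {ffun 'I_N -> {perm 'I_m}})
    (x : 'I_N * 'I_m) : 'I_N * 'I_m :=
  (s x.1, t x.1 x.2).

Definition same_arrangement : rel (placement m N n) := fun f g =>
  [exists s, exists t, g == [ffun i => relabel s t (f i)]].

(* The arrangements (same_arrangement classes of admissible placements) whose *)
(* number of non-empty compartments satisfies p; both admissible and          *)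
(* nb_compartments are constant on classes: see admissible_same and           *)
(* nb_compartments_same.                                                      *)
Definition arrangements (p : pred nat) : {set {set placement m N n}} :=
  equivalence_partition same_arrangement
    [set f | admissible f & p (nb_compartments f)].

Lemma relabel_inj s t : injective (relabel s t).
Proof.
by move=> [u c] [v d] [/perm_inj/= -> /perm_inj ->].
Qed.

Lemma same_arrangementP f g :
  reflect (exists s t, forall i, g i = relabel s t (f i))
          (same_arrangement f g).
Proof.
apply: (iffP existsP) => [[s /existsP[t /eqP->]]|[s [t gE]]]; exists s.
  by exists t => i; rewrite ffunE.
by apply/existsP; exists t; apply/eqP/ffunP => i; rewrite ffunE gE.
Qed.

Lemma same_arrangement_refl : reflexive same_arrangement.
Proof.
move=> f; apply/same_arrangementP; exists 1%g, [ffun=> 1%g] => i.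
by rewrite /relabel ffunE !perm1; case: (f i).
Qed.

Lemma same_arrangement_sym : symmetric same_arrangement.
Proof.
suff H f g : same_arrangement f g -> same_arrangement g f.
  by move=> f g; apply/idP/idP; apply: H.
case/same_arrangementP=> s [t gE]; apply/same_arrangementP.
exists s^-1%g, [ffun u => (t (s^-1%g u))^-1%g] => i.
by rewrite gE /relabel /= ffunE permK permK; case: (f i).
Qed.

Lemma same_arrangement_trans : transitive same_arrangement.
Proof.
move=> g f h /same_arrangementP[s [t gE]] /same_arrangementP[s' [t' hE]].
apply/same_arrangementP; exists (s * s')%g, [ffun u => (t u * t' (s u))%g] => i.
by rewrite hE gE /relabel /= ffunE !permM.
Qed.

Lemma same_arrangement_equiv :
  {in setT & &, equivalence_rel same_arrangement}.
Proof.
move=> f g h _ _ _; split=> [|fg]; first exact: same_arrangement_refl.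
apply/idP/idP; apply: same_arrangement_trans => //.
by rewrite same_arrangement_sym.
Qed.

Lemma nb_compartments_same f g :
  same_arrangement f g -> nb_compartments f = nb_compartments g.
Proof.
case/same_arrangementP=> s [t gE]; rewrite /nb_compartments.
rewrite -(card_imset [set f i | i in 'I_n] (@relabel_inj s t)) -imset_comp.
by congr #|pred_of_set _|; apply: eq_imset => i; rewrite gE.
Qed.

Lemma admissible_same f g :
  same_arrangement f g -> admissible f = admissible g.
Proof.
case/same_arrangementP=> s [t gE].
have occE i x : occupied_before g i (relabel s t x) = occupied_before f i x.
  by apply: eq_existsb => j; rewrite gE (inj_eq (@relabel_inj s t)).
have fullE i u : urn_full_before g i (s u) = urn_full_before f i u.
  apply/forallP/forallP => H c; first by rewrite -occE; apply: H.
  by rewrite -[c](permKV (t u)) (occE i (u, _)).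
have usedE i u : urn_used_before g i (s u) = urn_used_before f i u.
  apply/existsP/existsP => -[c H]; last first.
    by exists (t u c); rewrite (occE i (u, c)).
  by exists ((t u)^-1%g c); rewrite -occE /relabel /= permKV.
apply: eq_forallb => i; rewrite /admissible_step gE occE fullE usedE.
congr (_ && (_ ==> _)); apply/forallP/forallP => H u.
  by rewrite -[u](permKV s) usedE fullE.
by rewrite -usedE -fullE.
Qed.

End Placements.

(* Main.v *)
Require Import Defs.
From mathcomp Require Import all_boot all_fingroup.
From mathcomp Require Import zify.

(** The theorem rests on a canonical form.  The constraints force the urns to
    be filled one after the other, so when k compartments are in use, the k
    first compartments of the sequence urn 0, urn 1, ... (m consecutive numbers
    per urn) are used once every compartment is renamed by its rank of first
    use.  The next marble then either goes to one of the m * (k %/ m)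
    compartments lying in a full urn, or opens the compartment number k.
    Recording the compartment number of every marble turns a canonical
    placement into a word; the words with k letters in use are counted by the
    very recurrence of [mstirling].

    Two facts make canonical placements represent arrangements.  Existence
    ([canonize]): marble after marble, the newly opened compartment can be moved
    to number k by transposing two urns and two compartments, and this moves no
    compartment used earlier.  Uniqueness ([canonical_unique]): a relabeling
    between two canonical placements fixes the compartments used so far, hence
    also the place of the next marble, whether that place is old or new.
    Canonical placements thus form a transversal of the arrangements, and
    [card_arrangements] expresses every count as a sum of m-Stirling numbers.

    For the Bell numbers, let X be the operator on formal sums of basis vectors
    e_k that sends e_k to m * (k %/ m) * e_k + e_(k+1), so that mstirling m n k
    is the coefficient of e_k in X^n e_0, and let T send e_k to e_(k+m).  Then
    X T = T (X + m) and X^m e_0 = T e_0, whence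
    X^(n+m) e_0 = T (X + m)^n e_0.  Expanding the binomial gives
    [mstirling_shift]; as T preserves residues modulo m, summing over a residue
    class gives the recurrence that characterizes the primitive Bell numbers. *)

Set Implicit Arguments.
Unset Strict Implicit.
Unset Printing Implicit Defensive.

(** * Words of canonical placements *)

Section Words.
Variable m : nat.

(** The letters that may follow a word using the letters 0, ..., k - 1: those
    of the full urns, and the first unused one. *)
Definition next_letter (k a : nat) : bool := (a < m * (k %/ m)) || (a == k).

Lemma next_letter_cases k a : next_letter k a -> a < k \/ a = k.
Proof.
case/orP=> [lta|/eqP]; last by right.
by left; apply: leq_trans lta _; rewrite mulnC leq_divM.
Qed.

(** The list follows the recurrence of [mstirling] clause by clause, so that its
    size is known by construction. *)
Fixpoint words (n k : nat) : seq (seq nat) :=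
  if n is n'.+1 then
    [seq rcons w a | w <- words n' k, a <- iota 0 (m * (k %/ m))]
    ++ (if k is k'.+1 then [seq rcons w k' | w <- words n' k'] else [::])
  else if k == 0 then [:: [::]] else [::].

Lemma size_words n k : size (words n k) = mstirling m n k.
Proof.
elim: n k => [|n IHn] k /=; first by case: eqP.
rewrite size_cat size_allpairs size_iota IHn mulnC.
by case: k => [|k]; rewrite ?size_map ?IHn.
Qed.

Lemma words_rconsP n k w :
  reflect (exists w' a k', [/\ w = rcons w' a, w' \in words n k',
             next_letter k' a & k = (a == k') + k'])
          (w \in words n.+1 k).
Proof.
have lek k' : m * (k' %/ m) <= k' by rewrite mulnC leq_divM.
rewrite /= mem_cat; apply: (iffP orP).
- case=> [/allpairsP[[w' a] /= [w'k]]|].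
    rewrite mem_iota /= add0n => lta ->; exists w', a, k; split=> //.
      by rewrite /next_letter lta.
    by rewrite ltn_eqF // (leq_trans lta).
  case: k => // k /mapP[w' w'k ->]; exists w', k, k; split=> //.
    by rewrite /next_letter eqxx orbT.
  by rewrite eqxx.
- case=> w' [a [k' [-> w'k' /orP[lta|/eqP->] ->]]].
    left; rewrite ltn_eqF ?(leq_trans lta) //; apply/allpairsP.
    by exists (w', a); split=> //=; rewrite mem_iota.
  by right; rewrite eqxx; apply: map_f.
Qed.

Lemma mem_word n k w a : w \in words n k -> (a \in w) = (a < k).
Proof.
elim: n k w => [|n IHn] k w.
  by rewrite /=; case: eqP => // ->; rewrite inE => /eqP->.
case/words_rconsP=> w' [b [k' [-> w'k' nxt ->]]].
rewrite mem_rcons inE (IHn _ _ w'k').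
by case: (next_letter_cases nxt); case: (b =P k'); lia.
Qed.

Lemma size_word n k w : w \in words n k -> size w = n.
Proof.
elim: n k w => [|n IHn] k w.
  by rewrite /=; case: eqP => // _; rewrite inE => /eqP->.
by case/words_rconsP=> w' [b [k' [-> /IHn<- _ _]]]; rewrite size_rcons.
Qed.

Lemma word_bound_inj n n' k k' w :
  w \in words n k -> w \in words n' k' -> k = k'.
Proof.
move=> wk wk'; have lt a : (a < k) = (a < k').
  by rewrite -(mem_word a wk) (mem_word a wk').
by have := lt k; have := lt k'; lia.
Qed.

Lemma words_bound n k w : w \in words n k -> k <= n.
Proof.
move=> wk; rewrite -(size_word wk) -[k in k <= _](size_iota 0).
apply: uniq_leq_size (iota_uniq _ _) _ => a.
by rewrite mem_iota (mem_word _ wk).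
Qed.

Lemma uniq_words n k : uniq (words n k).
Proof.
elim: n k => [|n IHn] k; first by rewrite /=; case: eqP.
rewrite cat_uniq; apply/and3P; split.
- apply: allpairs_uniq => //; first exact: iota_uniq.
  by move=> [? ?] [? ?] _ _ /rcons_inj.
- case: k => // k; apply/hasPn => _ /mapP[w wk ->].
  apply/allpairsP => -[[w' a] /= [w'k _ /rcons_inj[eqw _]]]; rewrite eqw in wk.
  (* the letter k would occur in w' according to w'k, but not to wk *)
  by have := word_bound_inj wk w'k; lia.
- by case: k => // k; rewrite map_inj_uniq // => w w' /rcons_inj[].
Qed.

(** Together with [mem_word], this makes every prefix of a canonical word a
    record of the number of compartments in use. *)
Lemma words_take n k w j : w \in words n k -> j < n ->
  exists2 k', take j w \in words j k' & next_letter k' (nth 0 w j).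
Proof.
elim: n k w => // n IHn k w /words_rconsP[w' [a [k' [-> w'k' nxt _]]]].
rewrite ltnS leq_eqVlt => /predU1P[->|ltjn]; have sw' := size_word w'k'.
  exists k'; rewrite -cats1 ?take_size_cat ?sw' //.
  by rewrite nth_cat sw' ltnn subnn.
rewrite -cats1 takel_cat ?sw' 1?ltnW // nth_cat sw' ltjn.
exact: IHn w'k' ltjn.
Qed.

End Words.

(** * Canonical placements *)

Section Canonical.
Variables m N n : nat.
Hypothesis m_gt0 : 0 < m.
Implicit Types (f g : placement m N n) (x : 'I_N * 'I_m) (i : 'I_n) (u : 'I_N).

Definition code x : nat := x.1 * m + x.2.

Lemma code_inj : injective code.
Proof.
have codeE x : code x %/ m = x.1 /\ code x %% m = x.2.
  by rewrite /code divnMDl // modnMDl divn_small ?modn_small ?addn0 ?ltn_ord.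
move=> [u c] [v d] eq_uv; have [q r] := codeE (v, d).
have [] := codeE (u, c); rewrite eq_uv q r => /= eqv eqd.
by congr (_, _); apply: val_inj.
Qed.

Definition word f : seq nat := [seq code (f i) | i : 'I_n].

Lemma size_word_of f : size (word f) = n.
Proof. by rewrite size_map size_enum_ord. Qed.

Lemma nth_word f i : nth 0 (word f) i = code (f i).
Proof. by rewrite (nth_map i) ?size_enum_ord // nth_ord_enum. Qed.

Lemma word_inj : injective word.
Proof.
by move=> f g fg; apply/ffunP => i; apply: code_inj; rewrite -!nth_word fg.
Qed.

Lemma mem_take_word f j (a : nat) :
  reflect (exists2 i : 'I_n, i < j & code (f i) = a) (a \in take j (word f)).
Proof.
apply: (iffP idP) => [/(nthP 0)[l]|[i ltij <-]].
  rewrite size_take_min size_word_of leq_min => /andP[ltlj ltln].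
  rewrite nth_take // -[l]/(val (Ordinal ltln)) nth_word.
  by exists (Ordinal ltln).
apply/(nthP 0); exists i; last by rewrite nth_take // nth_word.
by rewrite size_take_min size_word_of leq_min ltij ltn_ord.
Qed.

Lemma eq_take_word f g j :
  (forall i : 'I_n, i < j -> f i = g i) -> take j (word f) = take j (word g).
Proof.
move=> eq_fg; apply: (@eq_from_nth _ 0) => [|l].
  by rewrite !size_take_min !size_word_of.
rewrite size_take_min size_word_of leq_min => /andP[ltlj ltln].
by rewrite !nth_take // -[l]/(val (Ordinal ltln)) !nth_word eq_fg.
Qed.

(** When the marbles before i form a canonical prefix, the used compartments are
    those of number below k, so the conditions on urns become inequalities. *)
Section Prefix.
Variables (f : placement m N n) (i : 'I_n) (k : nat).
Hypothesis fik : take i (word f) \in words m i k.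

Lemma occupied_code x : occupied_before f i x = (code x < k).
Proof.
rewrite -(mem_word _ fik).
apply/existsP/mem_take_word => [[j /andP[ltji /eqP<-]]|[j ltji /code_inj<-]].
  by exists j.
by exists j; rewrite ltji eqxx.
Qed.

Lemma urn_full_code u : urn_full_before f i u = (u.+1 * m <= k).
Proof.
apply/forallP/idP => [H|le c].
  have ltm : m.-1 < m by rewrite prednK.
  by have := H (Ordinal ltm); rewrite occupied_code /code /=; lia.
by rewrite occupied_code /code /=; have := ltn_ord c; lia.
Qed.

Lemma urn_used_code u : urn_used_before f i u = (u * m < k).
Proof.
apply/existsP/idP => [[c]|lt]; first by rewrite occupied_code /code /=; lia.
by exists (Ordinal m_gt0); rewrite occupied_code /code /= addn0.
Qed.

Lemma admissible_step_next :
  next_letter m k (code (f i)) -> admissible_step f i.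
Proof.
rewrite /admissible_step occupied_code urn_full_code urn_used_code.
case: (f i) => u c; rewrite /next_letter /code /=.
have ltc := ltn_ord c; have := divn_eq k m; have := ltn_pmod k m_gt0.
move: (k %/ m) (k %% m) => q r ltr kE /orP[lta|/eqP aE]; apply/andP.
  have ltuq : u < q by rewrite -(ltn_pmul2r m_gt0); lia.
  have leuq : u.+1 * m <= q * m by rewrite leq_mul2r ltuq orbT.
  by split; apply/implyP; lia.
split.
- by rewrite aE ltnn.
- apply/implyP => nu; apply/forallP => v; rewrite urn_full_code urn_used_code.
  have -> : k = u * m by lia.
  by rewrite ltn_pmul2r // leq_mul2r; apply/implyP => ->; rewrite orbT.
Qed.

(** In the second case the marble opens a compartment that need not be the one
    numbered k.  The urn k %/ m is the only one that can be partly filled, and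
    while it is, no other urn may be opened; the bound on i ensures that this
    urn exists. *)
Lemma admissible_step_cases : i < N -> admissible_step f i ->
  next_letter m k (code (f i)) \/
  [/\ k <= code (f i), k %/ m <= (f i).1
    & 0 < k %% m -> (f i).1 = k %/ m :> nat].
Proof.
move=> ltiN; have lek := words_bound fik.
rewrite /admissible_step occupied_code urn_full_code urn_used_code.
case: (f i) => u c; rewrite /next_letter /code /=.
have ltc := ltn_ord c; have kE := divn_eq k m; have ltr := ltn_pmod k m_gt0.
have ltq : k %/ m < N.
  exact: leq_ltn_trans (leq_div _ _) (leq_ltn_trans lek ltiN).
case/andP=> /implyP old /implyP new.
have [ltak|leka] := ltnP (u * m + c) k.
  left; have := old ltak; rewrite -leq_divRL // -(leq_pmul2l m_gt0); lia.
have lequ : k %/ m <= u by rewrite -ltnS -(ltn_pmul2r m_gt0); lia.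
right; split=> // r_gt0; have [ltuk|leku] := boolP (u * m < k).
  by apply/eqP; rewrite eq_sym eqn_leq lequ leq_divRL // ltnW.
have /forallP/(_ (Ordinal ltq)) := new leku.
by rewrite urn_used_code urn_full_code /=; lia.
Qed.

End Prefix.

Definition canonical f : bool := word f \in words m n (nb_compartments f).

Lemma nb_compartments_word f k :
  word f \in words m n k -> nb_compartments f = k.
Proof.
move=> fk; have -> : nb_compartments f = size (undup (codom f)).
  rewrite -(card_uniqP (undup_uniq _)); apply: eq_card => x.
  by rewrite mem_undup; apply/imsetP/codomP => -[i]; [move=> _|]; exists i.
rewrite -(size_map code) -(undup_map_inj code_inj).
rewrite -(size_iota 0 k); apply/perm_size/uniq_perm => [||a].
- exact: undup_uniq.
- exact: iota_uniq.
rewrite mem_undup mem_iota -(mem_word a fk) /codom /image_mem -map_comp //.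
Qed.

Lemma word_surj k w : n <= N -> w \in words m n k -> exists f, word f = w.
Proof.
move=> lenN wk; have ltw (i : 'I_n) : nth 0 w i < N.
  apply: leq_trans lenN; apply: leq_trans (words_bound wk).
  by rewrite -(mem_word _ wk) mem_nth // (size_word wk).
have ltq (i : 'I_n) : nth 0 w i %/ m < N.
  exact: leq_ltn_trans (leq_div _ _) (ltw i).
have ltr (i : 'I_n) : nth 0 w i %% m < m by apply: ltn_pmod.
exists [ffun i => (Ordinal (ltq i), Ordinal (ltr i))].
apply: (@eq_from_nth _ 0) => [|j]; first by rewrite size_word_of (size_word wk).
rewrite size_word_of => ltjn; rewrite -[j]/(val (Ordinal ltjn)) nth_word ffunE.
by rewrite /code /= -divn_eq.
Qed.

Lemma card_canonical k : n <= N ->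
  #|[set f | canonical f & nb_compartments f == k]| = mstirling m n k.
Proof.
move=> lenN; rewrite -size_words cardE -(size_map word).
apply/perm_size/uniq_perm => [||w].
- by rewrite (map_inj_uniq word_inj) enum_uniq.
- exact: uniq_words.
apply/mapP/idP => [[f]|wk].
  by rewrite mem_enum inE => /andP[fc /eqP<-] ->.
have [f fE] := word_surj lenN wk; rewrite -fE in wk; exists f => //.
by rewrite mem_enum inE /canonical (nb_compartments_word wk) wk eqxx.
Qed.

Lemma canonical_take f i : canonical f ->
  exists2 k, take i (word f) \in words m i k & next_letter m k (code (f i)).
Proof.
move=> fc; have [k fk nxt] := words_take fc (ltn_ord i).
by rewrite nth_word in nxt; exists k.
Qed.

Lemma canonical_admissible f : canonical f -> admissible f.
Proof.
move=> fc; apply/forallP => i; have [k fk nxt] := canonical_take i fc.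
exact: admissible_step_next fk nxt.
Qed.

(** By induction on the marbles, the relabeling fixes every compartment used
    before the marble i.  If i goes to an old compartment in either placement,
    it does so in the other one and the two compartments agree; otherwise both
    are the compartment number k. *)
Lemma canonical_unique f g :
  canonical f -> canonical g -> same_arrangement f g -> f = g.
Proof.
move=> fc gc /same_arrangementP[s [t gE]]; apply/ffunP => i.
have [l] := ubnP (val i); elim: l i => // l IHl i; rewrite ltnS => leil.
have IHi (j : 'I_n) : j < i -> f j = g j.
  by move=> ltji; apply: IHl; apply: leq_trans leil.
have [k fk fnxt] := canonical_take i fc.
have [k' gk' gnxt] := canonical_take i gc.
have eq_take : take i (word f) = take i (word g).
  exact: eq_take_word.
rewrite -eq_take in gk'; have eqk := word_bound_inj fk gk'.
rewrite -{k'}eqk in gk' gnxt.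
(* the relabeling fixes the old compartments, and maps only them to old ones *)
case: (next_letter_cases fnxt) => [lt_f|f_new].
  have [|j ltji /code_inj eq_ij] := mem_take_word f i (code (f i)) _.
    by rewrite (mem_word _ fk).
  by rewrite gE -eq_ij -gE IHi.
case: (next_letter_cases gnxt) => [lt_g|g_new]; last first.
  by apply: code_inj; rewrite f_new.
have [|j ltji /code_inj eq_ij] := mem_take_word g i (code (g i)) _.
  by rewrite -eq_take (mem_word _ fk).
move: (eq_ij); rewrite !gE => /relabel_inj eq_fij.
by rewrite -eq_fij -gE IHi.
Qed.

(** The prefixes are made canonical one marble at a time.  The transpositions
    that bring the new compartment to number k are the identity on the
    compartments used so far: when the urn k %/ m is partly used, the marble
    went into that urn already, and only two of its empty compartments are
    exchanged; otherwise two unused urns are. *)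
Lemma canonize f : n <= N -> admissible f ->
  exists2 g, canonical g & same_arrangement f g.
Proof.
move=> lenN fadm.
suff /(_ n (leqnn n))[g fg [k gk]] l : l <= n ->
    exists2 g, same_arrangement f g & exists k, take l (word g) \in words m l k.
  move: gk; rewrite take_oversize ?size_word_of // => gk.
  by exists g; rewrite // /canonical (nb_compartments_word gk).
elim: l => [|l IHl] ltln.
  by exists f; [apply: same_arrangement_refl|exists 0; rewrite take0].
have [g fg [k gk]] := IHl (ltnW ltln); pose i := Ordinal ltln.
have takeS h : take l.+1 (word h) = rcons (take l (word h)) (code (h i)).
  by rewrite (take_nth 0) ?size_word_of // -[l in nth _ _ l]/(val i) nth_word.
have gstep : admissible_step g i.
  by move: fadm; rewrite (admissible_same fg) => /forallP.
have [nxt|[le_code leq_u eq_u]] :=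
    admissible_step_cases (i := i) gk (leq_trans ltln lenN) gstep.
  exists g => //; eexists; rewrite takeS; apply/words_rconsP.
  by exists (take l (word g)), (code (g i)), k; split.
have ltq : k %/ m < N.
  by apply: leq_ltn_trans leq_u (ltn_ord _).
pose q := Ordinal ltq; pose r := Ordinal (ltn_pmod k m_gt0).
(* exchange the compartment of the marble i with the compartment number k *)
pose s := tperm (g i).1 q.
pose t := [ffun u => if u == (g i).1 then tperm (g i).2 r else 1%g].
pose h : placement m N n := [ffun j => relabel s t (g j)].
have gh : same_arrangement g h.
  by apply/same_arrangementP; exists s, t => j; rewrite ffunE.
have hi : code (h i) = k.
  by rewrite ffunE /relabel ffunE eqxx /code !tpermL /= -divn_eq.
have h_old (j : 'I_n) : j < l -> h j = g j.
  move=> ltjl; have ltk : code (g j) < k.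
    by rewrite -(mem_word _ gk); apply/mem_take_word; exists j.
  have kE := divn_eq k m; have ltr := ltn_ord (g j).2.
  rewrite ffunE [RHS]surjective_pairing /relabel ffunE.
  have [eq_ji|neq_ji] := eqVneq (g j).1 (g i).1.
    have eq_iq : (g i).1 = q.
      apply/val_inj/eqP; rewrite /= eqn_leq leq_u andbT leq_divRL // -eq_ji.
      by move: ltk; rewrite /code; lia.
    move: ltk le_code.
    rewrite /code eq_ji /s eq_iq tperm1 perm1 /= => ltk le_code.
    by congr (_, _); rewrite tpermD // -val_eqE /=; lia.
  rewrite perm1; congr (_, _); rewrite tpermD // 1?eq_sym //.
  apply: contraNneq neq_ji => eq_jq; apply/eqP/val_inj; rewrite /= eq_u.
    by rewrite eq_jq.
  by move: ltk; rewrite /code eq_jq /=; lia.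
exists h; first exact: same_arrangement_trans fg gh.
exists k.+1; rewrite takeS hi; apply/words_rconsP.
exists (take l (word h)), k, k; split=> //; last by rewrite eqxx.
  suff -> : take l (word h) = take l (word g) by [].
  exact: eq_take_word.
by rewrite /next_letter eqxx orbT.
Qed.

(** Canonical placements form a transversal of the arrangements; grouping them
    by their number of compartments leaves the cardinals of
    [card_canonical]. *)
Lemma card_arrangements p : n <= N ->
  #|arrangements m N n p| = \sum_(k < n.+1 | p k) mstirling m n k.
Proof.
move=> lenN; pose X := [set f | canonical f & p (nb_compartments f)].
pose D : {set placement m N n} :=
  [set f | admissible f & p (nb_compartments f)].
have eqD : {in D & &, equivalence_rel (@same_arrangement m N n)}.
  by move=> f g h _ _ _; apply: same_arrangement_equiv; rewrite inE.
have <- : #|X| = #|arrangements m N n p|.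
  apply: (@card_transversal _ X _ D); rewrite /is_transversal.
  rewrite equivalence_partitionP //=; apply/andP; split.
    by apply/subsetP => f; rewrite !inE => /andP[/canonical_admissible-> ->].
  apply/forall_inP => _ /imsetP[f fD ->].
  have [fadm pf] : admissible f /\ p (nb_compartments f).
    by move: fD; rewrite inE => /andP.
  have [g gc fg] := canonize lenN fadm.
  apply/cards1P; exists g; apply/setP => h; rewrite !inE.
  apply/idP/eqP => [/andP[/andP[hc _] /andP[_ fh]]|->].
    apply: canonical_unique => //; apply: same_arrangement_trans fg.
    by rewrite same_arrangement_sym.
  by rewrite gc fg -(nb_compartments_same fg) pf -(admissible_same fg) fadm.
have bound f : canonical f -> nb_compartments f < n.+1 by move/words_bound.
rewrite -sum1_card (partition_big (fun f => inord (nb_compartments f) : 'I_n.+1)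
  (fun k : 'I_n.+1 => p k)) /=; last first.
  by move=> f; rewrite inE => /andP[fc pf]; rewrite inordK ?bound.
apply: eq_bigr => k pk; rewrite -card_canonical // -sum1_card.
apply: eq_bigl => f.
rewrite !inE; case fc: (canonical f) => //=.
rewrite -val_eqE /= inordK ?bound //.
by case: eqP => [->|_]; rewrite ?pk ?andbF.
Qed.

End Canonical.

(** * The recurrence of the residue class sums *)

Lemma mstirling_small m n k : k < m -> mstirling m n k = (k == n).
Proof.
elim: n k => [|n IHn] k ltkm //=.
rewrite divn_small // muln0 mul0n add0n.
by case: k ltkm => // k ltkm; rewrite IHn 1?ltnW // eqSS.
Qed.

Lemma mstirling_large m n k : n < k -> mstirling m n k = 0.
Proof.
elim: n k => [|n IHn] [|k] //= ltnk.
by rewrite !IHn ?muln0 // ltnW.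
Qed.

(** The exponential-shift form of Pascal's rule: this is (X + c)^(n+1) =
    c (X + c)^n + (X + c)^n X, where X^j stands for g j. *)
Lemma binomial_sum_recl (c n : nat) (g : nat -> nat) :
  \sum_(j < n.+2) 'C(n.+1, j) * c ^ (n.+1 - j) * g j =
  c * (\sum_(j < n.+1) 'C(n, j) * c ^ (n - j) * g j)
  + \sum_(j < n.+1) 'C(n, j) * c ^ (n - j) * g j.+1.
Proof.
rewrite big_ord_recl bin0 subn0 /=.
under eq_bigr => i _ do rewrite /bump leq0n add1n binS subSS !mulnDl.
rewrite big_split /= addnA; congr (_ + _).
rewrite big_ord_recr /= bin_small // !mul0n addn0.
rewrite big_ord_recl /= bin0 subn0 mulnDr big_distrr /=; congr (_ + _).
  by rewrite expnS !mul1n mulnA.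
apply: eq_bigr => i _; rewrite /bump leq0n add1n.
by rewrite -[n - i](@prednK) ?subn_gt0 // -subnS expnS !mulnA [c * _]mulnC.
Qed.

(** For the operators X (e_k to m * (k %/ m) * e_k + e_(k+1)) and T (e_k to
    e_(k+m)), this is the coefficient of e_(k+m) in
    X^(n+m) e_0 = T (X + m)^n e_0. *)
Lemma mstirling_shift m n k : 0 < m ->
  mstirling m (n + m) (k + m) =
  \sum_(j < n.+1) 'C(n, j) * m ^ (n - j) * mstirling m j k.
Proof.
move=> m_gt0; elim: n k => [|n IHn] k.
  rewrite big_ord_recl big_ord0 bin0 expn0 !mul1n addn0 add0n /=.
  case: k => [|k]; last by rewrite mstirling_large // addSn ltnS leq_addl.
  case: m m_gt0 => // p _; rewrite add0n /=.
  by rewrite mstirling_large // muln0 mstirling_small ?eqxx.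
rewrite (binomial_sum_recl m n (mstirling m ^~ k)) -IHn addSn /=.
rewrite divnDr // divnn m_gt0.
(* this is X T = T (X + m): the factor of e_(k+m) exceeds that of e_k by m *)
have -> : m * (k %/ m + 1) * mstirling m (n + m) (k + m) =
          m * mstirling m (n + m) (k + m)
          + m * (k %/ m) * mstirling m (n + m) (k + m) by lia.
rewrite -addnA; congr (_ + _).
under [RHS]eq_bigr => j _ do rewrite /= mulnDr.
rewrite big_split /=; congr (_ + _).
  by rewrite IHn big_distrr; apply: eq_bigr => j _; rewrite /= mulnCA.
case: k => [|k]; last by rewrite addSn IHn.
rewrite big1 => [|j _]; last by rewrite muln0.
have [p mE] : exists p, m = p.+1 by exists m.-1; rewrite prednK.
rewrite add0n {1}mE mstirling_small ?mE // ltn_eqF //; lia.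
Qed.

(** Sum [mstirling_shift] over the k in the residue class, which is stable under
    the shift by m. *)
Lemma mstirling_residue_bell m r : r < m ->
  is_primitive_bell m r
    (fun n => \sum_(k < n.+1 | k == r %[mod m]) mstirling m n k).
Proof.
move=> ltrm; have m_gt0 : 0 < m := leq_ltn_trans (leq0n r) ltrm.
split=> n => [ltnm|].
  rewrite -(big_mkord (fun k => k == r %[mod m])) big_mkcond big_nat_recr //=.
  rewrite big_nat big1 ?add0n => [|k /andP[_ ltkn]].
    by rewrite mstirling_small // eqxx !modn_small //; case: eqP.
  case: ifP => // _.
  by rewrite mstirling_small ?(ltn_eqF ltkn) ?(ltn_trans ltkn).
pose c j := 'C(n, j) * m ^ (n - j).
(* every inner sum may range up to n, as mstirling m j vanishes beyond j *)
transitivity (\sum_(j < n.+1) \sum_(k < n.+1 | k == r %[mod m])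
                c j * mstirling m j k); last first.
  apply: eq_bigr => j _; rewrite -big_distrr; congr (_ * _).
  rewrite -2!(big_mkord (fun k => k == r %[mod m])).
  rewrite (@big_cat_nat _ _ _ j.+1) //=.
  rewrite [X in _ + X]big_nat_cond [X in _ + X]big1 ?addn0 // => k.
  by case/andP=> /andP[ltjk _] _; apply: mstirling_large.
rewrite exchange_big /= -(big_mkord (fun k => k == r %[mod m])).
(* the indices below m contribute nothing, and the others are shifted by m *)
rewrite (@big_cat_nat _ _ _ m) ?leqW ?leq_addl //=.
rewrite big_nat_cond big1 ?add0n => [|k /andP[/andP[_ ltkm] _]]; last first.
  by rewrite mstirling_small // ltn_eqF // (leq_trans ltkm) ?leq_addl.
rewrite -{1}[m]add0n big_addn -addSn addnK big_mkord.
by apply: eq_big => [k|k _]; rewrite ?modnDr // mstirling_shift.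
Qed.

Theorem theorem7p13 (m : nat) (hm : 1 <= m) (n N : nat) (hN : n <= N) :
  (forall k : nat,
     mstirling m n k = #|arrangements m N n (fun c : nat => c == k)|) /\
  composite_bell m n = #|arrangements m N n (fun _ : nat => true)| /\
  (forall r : nat, r < m ->
     primitive_bell m r n
     = #|arrangements m N n (fun c : nat => c == r %[mod m])|).
Proof.
have bellE r : r < m ->
    primitive_bell m r n = \sum_(k < n.+1 | k == r %[mod m]) mstirling m n k.
  move=> ltrm.
  by rewrite -(primitive_bell_unique hm (mstirling_residue_bell ltrm)).
split=> [k|]; last split=> [|r ltrm]; rewrite card_arrangements //;
  last exact: bellE.
- have [ltnk|lekn] := ltnP n k.
    rewrite mstirling_large // big1 // => i /eqP ik.
    by have := ltn_ord i; rewrite ik ltnS leqNgt ltnk.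
  by rewrite (big_pred1 (Ordinal (lekn : k < n.+1))).
- pose residue (k : 'I_n.+1) := Ordinal (ltn_pmod k hm).
  rewrite (partition_big residue xpredT) //=.
  apply: eq_bigr => r _; rewrite bellE //; apply: eq_bigl => k.
  by rewrite -val_eqE /= [r %% m]modn_small.
Qed.
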